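(* Let $(\boldsymbol n^{k},T^{k},\boldsymbol u^{k})$ and $(\boldsymbol n^{k+1},T^{k+1},\boldsymbol u^{k+1})$ be consecutive time levels of a smooth solution of the semi-implicit scheme described in the context, with time step $\delta t_k>0$ (no restriction on the size of $\delta t_k$). Write $s^k=s(\boldsymbol n^k,T^k)$. Then the scheme satisfies the second law of thermodynamics in the sense that, pointwise in $\Omega$, $$\frac{s^{k+1}-s^k}{\delta t_k}\ \ge\ -\nabla\cdot\frac{\boldsymbol q^{k+1}}{T^{k+1}}-\nabla\cdot(\boldsymbol u_\star^k s^k)+\sum_{i=1}^M\nabla\cdot\Big(\boldsymbol J_i^{k+1}\frac{\mu_i^{k+1}+M_{w,i}gh}{T^{k+1}}\Big)+\boldsymbol q^{k+1}\cdot\nabla\frac1{T^{k+1}}-\sum_{i=1}^M\boldsymbol J_i^{k+1}\cdot\nabla\frac{\mu_i^{k+1}+M_{w,i}gh}{T^{k+1}}+\frac1{T^{k+1}}\Big(\lambda^k|\nabla\cdot\boldsymbol u^{k+1}|^2+\tfrac12\eta^k|\boldsymbol\varepsilon(\boldsymbol u^{k+1})|^2\Big).$$ Moreover, for an isolated system, with $\mathcal S^k=\int_\Omega s^k\,d\boldsymbol x$ and $(\cdot,\cdot)$ the $L^2(\Omega)$ inner product, $$\frac{\mathcal S^{k+1}-\mathcal S^k}{\delta t_k}\ \ge\ \Big(\boldsymbol q^{k+1},\nabla\frac1{T^{k+1}}\Big)-\sum_{i=1}^M\Big(\boldsymbol J_i^{k+1},\nabla\frac{\mu_i^{k+1}+M_{w,i}gh}{T^{k+1}}\Big)+\Big(\lambda^k|\nabla\cdot\boldsymbol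 u^{k+1}|^2+\tfrac12\eta^k|\boldsymbol\varepsilon(\boldsymbol u^{k+1})|^2,\frac1{T^{k+1}}\Big)\ \ge\ 0.$$
   Context: Setting. $\Omega\subset\mathbb R^d$ is a bounded domain. A fluid mixture has $M$ components; $\boldsymbol n=(n_1,\dots,n_M)$ are positive molar densities, $T>0$ is the temperature, $\boldsymbol u$ a velocity field, $M_{w,i}>0$ the molar weights, $\rho=\sum_{i=1}^M n_iM_{w,i}>0$ the mass density, $g\ge0$ the gravity constant, $h$ the (smooth) height function, $\boldsymbol g=-g\nabla h$. All functions are smooth enough for the expressions below to make sense pointwise. Helmholtz free energy density. $f(\boldsymbol n,T)=f_b(\boldsymbol n,T)+f_\nabla(\boldsymbol n,T)$ with $f_\nabla(\boldsymbol n,T)=\frac12\sum_{i,j=1}^M c_{ij}(T)\nabla n_i\cdot\nabla n_j$. Standing assumptions: (i) the $c_{ij}$ depend on $T$ only, and $(c_{ij})$ is symmetric and positive semidefinite (i.e. $f_\nabla$ is convex with respect to the molar densities); (ii) $f_b=f_b^{\rm convex}+f_b^{\rm concave}$ where, for each $T$, $f_b^{\rm convex}(\cdot,T)$ is convex and $f_b^{\rm concave}(\cdot,T)$ is concave in $\boldsymbol n$ on a convex set of admissible densities; (iii) $\big(\partial^2 f/\partial T^2\big)_{\boldsymbol n}\le 0$ always, i.e. for fixed density fields $\boldsymbol n$, $T\mapsto f_b(\boldsymbol n,T)+\frac12\sum_{i,j}c_{ij}(T)\nabla n_i\cdot\nabla n_j$ has nonpositive second derivative on the interval of admissible temperatures.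 The entropy density is $s(\boldsymbol n,T)=-\frac{\partial f_b}{\partial T}(\boldsymbol n,T)-\frac12\sum_{i,j}c_{ij}'(T)\nabla n_i\cdot\nabla n_j$. Notation. A superscript $k$ denotes the approximation at time $t_k$, $\delta t_k=t_{k+1}-t_k>0$; $\rho^k=\sum_i n_i^kM_{w,i}$, $f^k=f(\boldsymbol n^k,T^k)$, $s^k=s(\boldsymbol n^k,T^k)$, $c_{ij}^k=c_{ij}(T^k)$; $\lambda^k,\eta^k>0$ are given viscosity coefficient functions. $\boldsymbol\varepsilon(\boldsymbol u)=\nabla\boldsymbol u+\nabla\boldsymbol u^T$, $|\cdot|$ of a tensor is the Frobenius norm, $\boldsymbol I$ is the identity tensor, and $\boldsymbol v\cdot\nabla\boldsymbol u$ has components $\sum_b v_b\partial_b u_a$. Scheme. Discrete chemical potentials: $\mu_i^{k+1}=\frac{\partial f_b^{\rm convex}}{\partial n_i}(\boldsymbol n^{k+1},T^{k+1})+\frac{\partial f_b^{\rm concave}}{\partial n_i}(\boldsymbol n^{k},T^{k+1})-\sum_{j=1}^M\nabla\cdot(c_{ij}^{k+1}\nabla n_j^{k+1})$. Diffusion and heat fluxes: $\boldsymbol J_i^{k+1}=-\sum_{j=1}^M\mathcal L_{i,j}(\boldsymbol n^k,T^k)\nabla\frac{\mu_j^{k+1}+M_{w,j}gh}{T^{k+1}}+\mathcal L_{i,M+1}(\boldsymbol n^k,T^k)\nabla\frac1{T^{k+1}}$ for $1\le i\le M$, $\boldsymbol q^{k+1}=-\sum_{j=1}^M\mathcal L_{M+1,j}(\boldsymbol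 n^k,T^k)\nabla\frac{\mu_j^{k+1}+M_{w,j}gh}{T^{k+1}}+\mathcal L_{M+1,M+1}(\boldsymbol n^k,T^{k+1})\nabla\frac1{T^{k+1}}$, where the $(M+1)\times(M+1)$ coefficient matrix occurring in these two formulas is symmetric positive semidefinite at every point. Intermediate velocity: $\boldsymbol u_\star^k=\boldsymbol u^k-\frac{\delta t_k}{\rho^k}\big(\sum_{i=1}^M n_i^k\nabla\mu_i^{k+1}+s^k\nabla T^{k+1}-\rho^k\boldsymbol g\big)$. Mass balance: $\frac{n_i^{k+1}-n_i^k}{\delta t_k}+\nabla\cdot(n_i^k\boldsymbol u_\star^k)+\nabla\cdot\boldsymbol J_i^{k+1}=0$, $1\le i\le M$. Momentum balance: $\rho^k\big(\frac{\boldsymbol u^{k+1}-\boldsymbol u_\star^k}{\delta t_k}+\boldsymbol u_\star^k\cdot\nabla\boldsymbol u^{k+1}\big)+\sum_{i=1}^M M_{w,i}\boldsymbol J_i^{k+1}\cdot\nabla\boldsymbol u^{k+1}=\nabla\cdot\boldsymbol\tau^{k+1}$, with $\boldsymbol\tau^{k+1}=(\lambda^k\nabla\cdot\boldsymbol u^{k+1})\boldsymbol I+\eta^k\boldsymbol\varepsilon(\boldsymbol u^{k+1})$. Energies and pressure: $e_t^k=f^k+T^ks^k+\frac12\rho^k|\boldsymbol u^k|^2+\rho^kgh$, $e_{t\star}^k=f^{k+1}+T^{k+1}s^k+\frac12\rho^k|\boldsymbol u^{k+1}|^2+\rho^kgh$, $p^{k+1}=\sum_{i=1}^M n_i^k\mu_i^{k+1}-f^{k+1}$.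 Total energy conservation: $\frac{e_t^{k+1}-e_t^k}{\delta t_k}+\nabla\cdot\big(\boldsymbol u_\star^k(e_{t\star}^k+p^{k+1})-\boldsymbol\tau^{k+1}\cdot\boldsymbol u^{k+1}\big)=-\nabla\cdot(\boldsymbol q^{k+1}-\boldsymbol\pi^{k+1})$, with $\boldsymbol\pi^{k+1}=\sum_{i,j=1}^M c_{ij}^{k+1}\frac{n_i^{k+1}-n_i^k}{\delta t_k}\nabla n_j^{k+1}-\frac12\sum_{i=1}^M M_{w,i}|\boldsymbol u^{k+1}|^2\boldsymbol J_i^{k+1}$. Isolated system: the boundary conditions on $\partial\Omega$ (e.g. homogeneous Neumann) are such that all boundary terms vanish on integrating by parts; in particular the integrals over $\Omega$ of $\nabla\cdot(\boldsymbol q^{k+1}/T^{k+1})$, $\nabla\cdot(\boldsymbol u_\star^ks^k)$ and $\nabla\cdot\big(\boldsymbol J_i^{k+1}(\mu_i^{k+1}+M_{w,i}gh)/T^{k+1}\big)$ are zero. *)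

(* Defs.v *)
From HB Require Import structures.
From mathcomp Require Import all_boot all_order all_algebra.
From mathcomp Require Import all_classical all_reals all_analysis.

Set Implicit Arguments.
Unset Strict Implicit.
Unset Printing Implicit Defensive.

Import Order.TTheory GRing.Theory Num.Theory.
Import numFieldNormedType.Exports.

Local Open Scope ring_scope.
Local Open Scope classical_set_scope.

(* Lebesgue measure on R^n, carried by n.-tuple R with the product
   sigma-algebra: the unit mass for n = 0, and the image of the product of the
   n-dimensional and the 1-dimensional measures under (t, a) |-> a :: t. *)
Section lebesgue_measure_tuple.
Variable R : realType.
Local Notation mR := (measurableTypeR R).

Definition tcons n (p : n.-tuple mR * mR) : n.+1.-tuple mR :=
  [tuple of p.2 :: p.1].

Lemma measurable_tcons n : measurable_fun [set: n.-tuple mR * mR] (@tcons n).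
Proof. exact: measurable_cons. Qed.

Definition lebesgue_tuple_succ n (m : {measure set (n.-tuple mR) -> \bar R}) :
    {measure set (n.+1.-tuple mR) -> \bar R} :=
  measure_function_pushforward__canonical__measure_function_Measure
    (m \x (@lebesgue_measure R))%E (@measurable_tcons n).

Fixpoint lebesgue_tuple n : {measure set (n.-tuple mR) -> \bar R} :=
  match n with
  | 0 => \d_ [tuple]
  | n'.+1 => lebesgue_tuple_succ (lebesgue_tuple n')
  end.

Lemma measurable_box n (A : 'I_n -> set mR) :
  (forall i, measurable (A i)) ->
  measurable [set t : n.-tuple mR | forall i, A i (tnth t i)].
Proof.
move=> mA.
rewrite (_ : mkset _ =
  \big[setI/setT]_(i < n) ((fun t : n.-tuple mR => tnth t i) @^-1` A i)).
  apply: bigsetI_measurable => i _; rewrite -[_ @^-1` _]setTI.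
  exact: measurable_tnth.
rewrite -bigcap_seq; apply/seteqP; split=> t /= At i; first by move=> _; exact: At.
by apply: At; rewrite /= mem_index_enum.
Qed.

Lemma lebesgue_tuple_box n (A : 'I_n -> set mR) :
  (forall i, measurable (A i)) ->
  lebesgue_tuple n [set t | forall i, A i (tnth t i)] =
  (\prod_(i < n) lebesgue_measure (A i))%E.
Proof.
elim: n A => [|n IHn] A mA.
  by rewrite big_ord0 /= /dirac indicE mem_set//= => -[].
rewrite big_ord_recl muleC -IHn//.
rewrite -product_measure1E; [|by apply: (measurable_box (A := fun i => A (lift ord0 i)))|exact: mA].
rewrite /= /pushforward; congr (_ _); apply/seteqP; split=> -[t a] /= At.
  split=> [i|]; last exact: (At ord0).
  by have := At (lift ord0 i); rewrite tnthS.
by case: At => At Aa i; case: (unliftP ord0 i) => [j|] ->; rewrite ?tnthS.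
Qed.

End lebesgue_measure_tuple.

Section vector_calculus.
Variables (R : realType) (d : nat).
Implicit Types (f : 'rV[R]_d -> R) (v u : 'rV[R]_d -> 'rV[R]_d).

Definition dotv (v w : 'rV[R]_d) : R := \sum_(a < d) v ord0 a * w ord0 a.

Definition partial (a : 'I_d) f (x : 'rV[R]_d) : R := 'D_(delta_mx ord0 a) f x.

Definition gradient f (x : 'rV[R]_d) : 'rV[R]_d := \row_a partial a f x.

Definition divergence v (x : 'rV[R]_d) : R :=
  \sum_(a < d) partial a (fun y => v y ord0 a) x.

(* entry (b, a) is the derivative of u_a with respect to x_b, so that
   w *m vgrad u x has components \sum_b w_b (d u_a / d x_b) *)
Definition vgrad u (x : 'rV[R]_d) : 'M[R]_d :=
  \matrix_(b, a) partial b (fun y => u y ord0 a) x.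

Definition tensor_divergence (t : 'rV[R]_d -> 'M[R]_d) (x : 'rV[R]_d) :
    'rV[R]_d :=
  \row_a \sum_(b < d) partial b (fun y => t y a b) x.

Definition strain u (x : 'rV[R]_d) : 'M[R]_d := vgrad u x + (vgrad u x)^T.

Definition frobenius2 (A : 'M[R]_d) : R := \sum_(a < d) \sum_(b < d) A a b ^+ 2.

Definition differentiable_on (V : normedModType R) (Omega : set 'rV[R]_d)
    (f : 'rV[R]_d -> V) : Prop :=
  forall x, Omega x -> differentiable f x.

Definition bounded_domain (Omega : set 'rV[R]_d) : Prop :=
  [/\ open Omega, connected Omega, bounded_set Omega & Omega !=set0].

(* Integration over a subset of 'rV[R]_d, which has no measurable structure in
   the library, goes through the identification of tuples with row vectors. *)
Definition row_of_tuple (t : d.-tuple (measurableTypeR R)) : 'rV[R]_d :=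
  \row_a tnth t a.

Definition integral_over (Omega : set 'rV[R]_d) f : R :=
  Rintegral (lebesgue_tuple R d) (row_of_tuple @^-1` Omega) (f \o row_of_tuple).

Definition integrable_over (Omega : set 'rV[R]_d) f : Prop :=
  (lebesgue_tuple R d).-integrable (row_of_tuple @^-1` Omega)
    (EFin \o (f \o row_of_tuple)).

End vector_calculus.

Definition psd_mx (R : realType) n (A : 'M[R]_n) : Prop :=
  A^T = A /\ forall v : 'rV[R]_n, 0 <= (v *m A *m v^T) ord0 ord0.

Definition twice_derivable_at (R : realType) (f : R -> R) (t : R) : Prop :=
  derivable f t 1 /\ derivable (derive1 f) t 1.

(* Constitutive data of an M-component fluid in R^d. The Onsager coefficients
   are indexed by 'I_M.+1, the component i being widen_ord (leqnSn M) i and the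
   heat index M + 1 being ord_max. *)
Record fluid (R : realType) (M d : nat) := Fluid {
  fb_convex : 'rV[R]_M -> R -> R;
  fb_concave : 'rV[R]_M -> R -> R;
  influence : R -> 'M[R]_M;
  mol_weight : 'I_M -> R;
  onsager : 'rV[R]_M -> R -> 'M[R]_M.+1;
  gravity : R;
  height : 'rV[R]_d -> R;
  adm_density : set 'rV[R]_M;
  adm_temp : set R
}.

Record state (R : realType) (M d : nat) := State {
  density : 'rV[R]_d -> 'rV[R]_M;
  temp : 'rV[R]_d -> R;
  velocity : 'rV[R]_d -> 'rV[R]_d
}.

Record time_step (R : realType) (M d : nat) := TimeStep {
  old : state R M d;
  new : state R M d;
  dt : R;
  bulk_visc : 'rV[R]_d -> R;
  shear_visc : 'rV[R]_d -> R
}.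

Section thermodynamics.
Variables (R : realType) (M d : nat) (F : fluid R M d).
Implicit Types (n : 'rV[R]_d -> 'rV[R]_M) (x : 'rV[R]_d) (S : state R M d).

Definition fb (nu : 'rV[R]_M) (t : R) : R :=
  fb_convex F nu t + fb_concave F nu t.

Definition density_grad n (i : 'I_M) x : 'rV[R]_d :=
  gradient (fun y => n y ord0 i) x.

Definition f_gradient n x (t : R) : R :=
  2^-1 * \sum_(i < M) \sum_(j < M)
    influence F t i j * dotv (density_grad n i x) (density_grad n j x).

Definition free_energy_at n x (t : R) : R := fb (n x) t + f_gradient n x t.

Definition free_energy S x : R := free_energy_at (density S) x (temp S x).

Definition entropy S x : R :=
  - derive1 (fb (density S x)) (temp S x)
  - 2^-1 * \sum_(i < M) \sum_(j < M)
      derive1 (fun t => influence F t i j) (temp S x)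
      * dotv (density_grad (density S) i x) (density_grad (density S) j x).

Definition mass_density S x : R :=
  \sum_(i < M) density S x ord0 i * mol_weight F i.

Definition total_energy S x : R :=
  free_energy S x + temp S x * entropy S x
  + 2^-1 * mass_density S x * dotv (velocity S x) (velocity S x)
  + mass_density S x * gravity F * height F x.

Record fluid_assumptions (Omega : set 'rV[R]_d) : Prop := {
  mol_weight_gt0 : forall i, 0 < mol_weight F i;
  gravity_ge0 : 0 <= gravity F;
  height_diff : differentiable_on Omega (height F);
  adm_density_convex : convex_set (adm_density F);
  adm_density_gt0 : forall nu, adm_density F nu -> forall i, 0 < nu ord0 i;
  adm_temp_itv : is_interval (adm_temp F);
  adm_temp_gt0 : forall t, adm_temp F t -> 0 < t;
  influence_psd : forall t, adm_temp F t -> psd_mx (influence F t);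
  fb_convexP : forall t, adm_temp F t ->
    convex_function (adm_density F) (fun nu => fb_convex F nu t);
  fb_concaveP : forall t, adm_temp F t ->
    convex_function (adm_density F) (fun nu => - fb_concave F nu t);
  fb_convex_diff : forall nu t, adm_density F nu -> adm_temp F t ->
    differentiable (fun nu => fb_convex F nu t) nu;
  fb_concave_diff : forall nu t, adm_density F nu -> adm_temp F t ->
    differentiable (fun nu => fb_concave F nu t) nu;
  fb_twice_derivable : forall nu t, adm_density F nu -> adm_temp F t ->
    twice_derivable_at (fb nu) t;
  influence_twice_derivable : forall i j t, adm_temp F t ->
    twice_derivable_at (fun t => influence F t i j) t;
  free_energy_concave_temp : forall n,
    (forall x, Omega x -> adm_density F (n x)) -> differentiable_on Omega n ->
    forall x t, Omega x -> adm_temp F t -> derive1n 2 (free_energy_at n x) t <= 0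
}.

End thermodynamics.

Section scheme.
Variables (R : realType) (M d : nat) (F : fluid R M d) (D : time_step R M d).
Implicit Types (x : 'rV[R]_d) (i : 'I_M).

Local Notation comp i := (widen_ord (leqnSn M) i).
Local Notation heat := (@ord_max M).

Definition dens_rate i x : R :=
  (density (new D) x ord0 i - density (old D) x ord0 i) / dt D.

(* influence matrix at the new temperature times gradient of the new density *)
Definition influence_flux (i j : 'I_M) x : 'rV[R]_d :=
  influence F (temp (new D) x) i j *: density_grad (density (new D)) j x.

Definition chem_potential i x : R :=
  'D_(delta_mx ord0 i) (fun nu => fb_convex F nu (temp (new D) x))
    (density (new D) x)
  + 'D_(delta_mx ord0 i) (fun nu => fb_concave F nu (temp (new D) x))
    (density (old D) x)
  - \sum_(j < M) divergence (influence_flux i j) x.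

Definition reduced_potential i x : R :=
  (chem_potential i x + mol_weight F i * gravity F * height F x)
  / temp (new D) x.

Definition inv_temp x : R := 1 / temp (new D) x.

Definition onsager_old x : 'M[R]_M.+1 :=
  onsager F (density (old D) x) (temp (old D) x).

Definition diffusion_flux i x : 'rV[R]_d :=
  - (\sum_(j < M) onsager_old x (comp i) (comp j)
       *: gradient (reduced_potential j) x)
  + onsager_old x (comp i) heat *: gradient inv_temp x.

(* the heat-heat coefficient is taken at the new temperature *)
Definition heat_flux x : 'rV[R]_d :=
  - (\sum_(j < M) onsager_old x heat (comp j)
       *: gradient (reduced_potential j) x)
  + onsager F (density (old D) x) (temp (new D) x) heat heat
      *: gradient inv_temp x.

(* the coefficients occurring in diffusion_flux and heat_flux *)
Definition flux_coef x : 'M[R]_M.+1 :=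
  \matrix_(a, b)
    if (a == heat) && (b == heat)
    then onsager F (density (old D) x) (temp (new D) x) a b
    else onsager_old x a b.

Definition gravity_vec x : 'rV[R]_d := - (gravity F *: gradient (height F) x).

Definition star_velocity x : 'rV[R]_d :=
  velocity (old D) x - (dt D / mass_density F (old D) x) *:
    (\sum_(i < M) density (old D) x ord0 i *: gradient (chem_potential i) x
     + entropy F (old D) x *: gradient (temp (new D)) x
     - mass_density F (old D) x *: gravity_vec x).

Definition stress x : 'M[R]_d :=
  (bulk_visc D x * divergence (velocity (new D)) x)%:M
  + shear_visc D x *: strain (velocity (new D)) x.

Definition star_energy x : R :=
  free_energy F (new D) x + temp (new D) x * entropy F (old D) x
  + 2^-1 * mass_density F (old D) x
      * dotv (velocity (new D) x) (velocity (new D) x)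
  + mass_density F (old D) x * gravity F * height F x.

Definition pressure x : R :=
  \sum_(i < M) density (old D) x ord0 i * chem_potential i x
  - free_energy F (new D) x.

Definition extra_flux x : 'rV[R]_d :=
  \sum_(i < M) \sum_(j < M) dens_rate i x *: influence_flux i j x
  - 2^-1 *: (\sum_(i < M)
      (mol_weight F i * dotv (velocity (new D) x) (velocity (new D) x))
        *: diffusion_flux i x).

Definition energy_flux x : 'rV[R]_d :=
  (star_energy x + pressure x) *: star_velocity x
  - \row_a \sum_(b < d) stress x a b * velocity (new D) x ord0 b.

Definition mass_balance x : Prop := forall i,
  dens_rate i x
  + divergence (fun y => density (old D) y ord0 i *: star_velocity y) x
  + divergence (diffusion_flux i) x = 0.

Definition momentum_balance x : Prop :=
  mass_density F (old D) x *:
    ((dt D)^-1 *: (velocity (new D) x - star_velocity x)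
     + star_velocity x *m vgrad (velocity (new D)) x)
  + \sum_(i < M)
      mol_weight F i *: (diffusion_flux i x *m vgrad (velocity (new D)) x)
  = tensor_divergence stress x.

Definition energy_balance x : Prop :=
  (total_energy F (new D) x - total_energy F (old D) x) / dt D
  + divergence energy_flux x
  = - divergence (fun y => heat_flux y - extra_flux y) x.

Record admissible_step (Omega : set 'rV[R]_d) : Prop := {
  dt_gt0 : 0 < dt D;
  old_density_adm : forall x, Omega x -> adm_density F (density (old D) x);
  new_density_adm : forall x, Omega x -> adm_density F (density (new D) x);
  old_temp_adm : forall x, Omega x -> adm_temp F (temp (old D) x);
  new_temp_adm : forall x, Omega x -> adm_temp F (temp (new D) x);
  bulk_visc_gt0 : forall x, Omega x -> 0 < bulk_visc D x;
  shear_visc_gt0 : forall x, Omega x -> 0 < shear_visc D x;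
  flux_coef_psd : forall x, Omega x -> psd_mx (flux_coef x)
}.

(* Every field that is differentiated in the scheme or in the entropy
   inequality is differentiable; products, sums and quotients of the fields
   below (energy flux, entropy flux) need no assumption of their own. *)
Record smooth_step (Omega : set 'rV[R]_d) : Prop := {
  old_density_diff : differentiable_on Omega (density (old D));
  new_density_diff : differentiable_on Omega (density (new D));
  new_temp_diff : differentiable_on Omega (temp (new D));
  new_velocity_diff : differentiable_on Omega (velocity (new D));
  old_entropy_diff : differentiable_on Omega (entropy F (old D));
  influence_flux_diff : forall i j, differentiable_on Omega (influence_flux i j);
  chem_potential_diff : forall i, differentiable_on Omega (chem_potential i);
  diffusion_flux_diff : forall i, differentiable_on Omega (diffusion_flux i);
  heat_flux_diff : differentiable_on Omega heat_flux;
  star_velocity_diff : differentiable_on Omega star_velocity;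
  stress_diff : differentiable_on Omega stress
}.

Record scheme_solution (Omega : set 'rV[R]_d) : Prop := {
  step_admissible : admissible_step Omega;
  step_smooth : smooth_step Omega;
  mass_balanceP : forall x, Omega x -> mass_balance x;
  momentum_balanceP : forall x, Omega x -> momentum_balance x;
  energy_balanceP : forall x, Omega x -> energy_balance x
}.

Definition viscous_dissipation x : R :=
  bulk_visc D x * `|divergence (velocity (new D)) x| ^+ 2
  + 2^-1 * shear_visc D x * frobenius2 (strain (velocity (new D)) x).

Definition no_net_flux (Omega : set 'rV[R]_d) (v : 'rV[R]_d -> 'rV[R]_d) :
    Prop :=
  integrable_over Omega (divergence v) /\
  integral_over Omega (divergence v) = 0.

Record isolated_system (Omega : set 'rV[R]_d) : Prop := {
  no_heat_entropy_flux :
    no_net_flux Omega (fun x => (temp (new D) x)^-1 *: heat_flux x);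
  no_convective_entropy_flux :
    no_net_flux Omega (fun x => entropy F (old D) x *: star_velocity x);
  no_diffusive_entropy_flux : forall i,
    no_net_flux Omega (fun x => reduced_potential i x *: diffusion_flux i x)
}.

(* the remaining integrals of the integrated entropy inequality are finite *)
Record finite_entropy_integrals (Omega : set 'rV[R]_d) : Prop := {
  old_entropy_integrable : integrable_over Omega (entropy F (old D));
  new_entropy_integrable : integrable_over Omega (entropy F (new D));
  heat_production_integrable : integrable_over Omega
    (fun x => dotv (heat_flux x) (gradient inv_temp x));
  diffusion_production_integrable : forall i, integrable_over Omega
    (fun x => dotv (diffusion_flux i x) (gradient (reduced_potential i) x));
  viscous_production_integrable :
    integrable_over Omega (fun x => viscous_dissipation x * inv_temp x)
}.

End scheme.

(* Main.v *)
(* The convex-concave splitting of the bulk energy, the positive semidefiniteness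
   of the influence matrix and the concavity in the temperature bound the
   increment of the free energy by tangents:
     f^{k+1} - f^k <= sum_i mu_i (n_i^{k+1} - n_i^k) + dt div(pi_1)
                      - s^k (T^{k+1} - T^k),
   where pi_1 is the part of pi that carries the influence coefficients.  The
   increment of the kinetic energy is bounded, via
   |a|^2 - |b|^2 <= 2 a.(a - b), by what the momentum balance and the definition
   of the intermediate velocity give.  When both are inserted in the energy
   balance, every convective term cancels and T^{k+1} (s^{k+1} - s^k) / dt is
   bounded below by heat and mass diffusion terms plus the viscous dissipation,
   the entropy being transported at the old level.  Dividing by T^{k+1} gives the
   local inequality; in the integrated one the divergences drop out, and the flux
   terms form the quadratic form of the positive semidefinite flux coefficients
   at the thermodynamic forces. *)
Require Import Defs.
From mathcomp Require Import all_boot all_order all_algebra.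
From mathcomp Require Import all_classical all_reals all_analysis.
From mathcomp Require Import ring lra.

Set Implicit Arguments.
Unset Strict Implicit.
Unset Printing Implicit Defensive.

Import Order.TTheory GRing.Theory Num.Theory.
Import numFieldNormedType.Exports.

Local Open Scope classical_set_scope.
Local Open Scope ring_scope.

(** * Product rules for gradients and divergences of differentiable fields *)

Section calculus.
Variables (R : realType) (d : nat).
Implicit Types (f g : 'rV[R]_d -> R) (v w : 'rV[R]_d -> 'rV[R]_d).
Implicit Types (x : 'rV[R]_d).

Lemma differentiable_entry m p (v : 'rV[R]_d -> 'M[R]_(m, p)) x i j :
  differentiable v x -> differentiable (fun y => v y i j : R) x.
Proof.
move=> dv.
apply: (@differentiable_comp _ _ _ _ v (fun N : 'M[R]_(m, p) => N i j)).
  exact: dv.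
exact: differentiable_coord.
Qed.

Lemma differentiable_bigsum (W : normedModType R) m
    (f : 'I_m -> 'rV[R]_d -> W) x :
  (forall i, differentiable (f i) x) ->
  differentiable (fun y => \sum_(i < m) f i y) x.
Proof.
move=> df; rewrite (_ : (fun y => _) = \sum_(i < m) f i).
  exact: differentiable_sum.
by apply/funext => y; rewrite fct_sumE.
Qed.

Lemma partial_cst a (c : R) x : partial a (fun=> c) x = 0.
Proof. exact: derive_cst. Qed.

Lemma partialD a f g x : differentiable f x -> differentiable g x ->
  partial a (fun y => f y + g y) x = partial a f x + partial a g x.
Proof. by move=> df dg; apply: deriveD; apply: diff_derivable. Qed.

Lemma partialN a f x : differentiable f x ->
  partial a (fun y => - f y) x = - partial a f x.
Proof. by move=> df; apply: deriveN; apply: diff_derivable. Qed.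

Lemma partialB a f g x : differentiable f x -> differentiable g x ->
  partial a (fun y => f y - g y) x = partial a f x - partial a g x.
Proof. by move=> df dg; apply: deriveB; apply: diff_derivable. Qed.

Lemma partialM a f g x : differentiable f x -> differentiable g x ->
  partial a (fun y => f y * g y) x = f x * partial a g x + g x * partial a f x.
Proof. by move=> df dg; apply: deriveM; apply: diff_derivable. Qed.

Lemma partial_sum a m (f : 'I_m -> 'rV[R]_d -> R) x :
  (forall i, differentiable (f i) x) ->
  partial a (fun y => \sum_(i < m) f i y) x = \sum_(i < m) partial a (f i) x.
Proof.
move=> df; rewrite /partial (_ : (fun y => _) = \sum_(i < m) f i).
  by apply: derive_sum => i; exact: diff_derivable.
by apply/funext => y; rewrite fct_sumE.
Qed.

Lemma dotvC (p q : 'rV[R]_d) : dotv p q = dotv q p.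
Proof. by apply: eq_bigr => a _; rewrite mulrC. Qed.

Lemma dotvDr (p q r : 'rV[R]_d) : dotv p (q + r) = dotv p q + dotv p r.
Proof. by rewrite -big_split; apply: eq_bigr => a _; rewrite mxE mulrDr. Qed.

Lemma dotvZr (c : R) (p q : 'rV[R]_d) : dotv p (c *: q) = c * dotv p q.
Proof. by rewrite big_distrr; apply: eq_bigr => a _; rewrite mxE /=; ring. Qed.

Lemma dotvNr (p q : 'rV[R]_d) : dotv p (- q) = - dotv p q.
Proof. by rewrite -scaleN1r dotvZr mulN1r. Qed.

Lemma dotvBr (p q r : 'rV[R]_d) : dotv p (q - r) = dotv p q - dotv p r.
Proof. by rewrite dotvDr dotvNr. Qed.

Lemma dotvBl (p q r : 'rV[R]_d) : dotv (q - r) p = dotv q p - dotv r p.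
Proof. by rewrite dotvC dotvBr !(dotvC p). Qed.

Lemma dotv_sqrB (p q : 'rV[R]_d) :
  dotv (p - q) (p - q) = dotv p p - 2 * dotv p q + dotv q q.
Proof. by rewrite dotvBr !dotvBl (dotvC q); ring. Qed.

Lemma dotv_sumr m (p : 'rV[R]_d) (q : 'I_m -> 'rV[R]_d) :
  dotv p (\sum_(i < m) q i) = \sum_(i < m) dotv p (q i).
Proof.
rewrite /dotv exchange_big; apply: eq_bigr => a _ /=.
by rewrite summxE big_distrr.
Qed.

Lemma dotv_ge0 (p : 'rV[R]_d) : 0 <= dotv p p.
Proof. by apply: sumr_ge0 => a _; exact: sqr_ge0. Qed.

Lemma differentiable_dotv v w x : differentiable v x -> differentiable w x ->
  differentiable (fun y => dotv (v y) (w y)) x.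
Proof.
move=> dv dw; apply: differentiable_bigsum => a.
by apply: differentiableM; exact: differentiable_entry.
Qed.

(** Expansion in the canonical basis gives a finite sum of scalar functions times constant vectors,
    so only products of scalar functions have to be differentiated. *)
Lemma differentiable_scale f v x : differentiable f x -> differentiable v x ->
  differentiable (fun y => f y *: v y) x.
Proof.
move=> df dv; rewrite (_ : (fun y => _) =
    \sum_(a < d) (fun y => (f y * v y ord0 a) *: delta_mx ord0 a)).
  apply: differentiable_sum => a; apply: differentiableZl.
  by apply: differentiableM => //; exact: differentiable_entry.
apply/funext => y; rewrite fct_sumE [v y in LHS]row_sum_delta scaler_sumr.
by apply: eq_bigr => a _; rewrite scalerA.
Qed.

Lemma divergenceD v w x : differentiable v x -> differentiable w x ->
  divergence (fun y => v y + w y) x = divergence v x + divergence w x.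
Proof.
move=> dv dw; rewrite -big_split; apply: eq_bigr => a _ /=.
rewrite -partialD; [|exact: differentiable_entry..].
by congr (partial _ _ x); apply/funext => y; rewrite mxE.
Qed.

Lemma divergenceN v x : differentiable v x ->
  divergence (fun y => - v y) x = - divergence v x.
Proof.
move=> dv; rewrite -sumrN; apply: eq_bigr => a _ /=.
rewrite -partialN; last exact: differentiable_entry.
by congr (partial _ _ x); apply/funext => y; rewrite mxE.
Qed.

Lemma divergenceB v w x : differentiable v x -> differentiable w x ->
  divergence (fun y => v y - w y) x = divergence v x - divergence w x.
Proof.
move=> dv dw; rewrite divergenceD//; last exact: differentiableN.
by rewrite divergenceN.
Qed.

Lemma divergence_sum m (v : 'I_m -> 'rV[R]_d -> 'rV[R]_d) x :
  (forall i, differentiable (v i) x) ->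
  divergence (fun y => \sum_(i < m) v i y) x = \sum_(i < m) divergence (v i) x.
Proof.
move=> dv; rewrite exchange_big; apply: eq_bigr => a _ /=.
rewrite -partial_sum; last by move=> i; exact: differentiable_entry.
by congr (partial _ _ x); apply/funext => y; rewrite summxE.
Qed.

Lemma divergence_scale f v x : differentiable f x -> differentiable v x ->
  divergence (fun y => f y *: v y) x =
  f x * divergence v x + dotv (v x) (gradient f x).
Proof.
move=> df dv; rewrite big_distrr -big_split; apply: eq_bigr => a _ /=.
rewrite mxE -partialM//; last exact: differentiable_entry.
by congr (partial _ _ x); apply/funext => y; rewrite mxE.
Qed.

Lemma gradientD f g x : differentiable f x -> differentiable g x ->
  gradient (fun y => f y + g y) x = gradient f x + gradient g x.
Proof. by move=> df dg; apply/rowP => a; rewrite !mxE partialD. Qed.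

Lemma gradientB f g x : differentiable f x -> differentiable g x ->
  gradient (fun y => f y - g y) x = gradient f x - gradient g x.
Proof. by move=> df dg; apply/rowP => a; rewrite !mxE partialB. Qed.

Lemma gradientZ f (c : R) x : differentiable f x ->
  gradient (fun y => c * f y) x = c *: gradient f x.
Proof.
move=> df; apply/rowP => a; rewrite !mxE partialM ?partial_cst//.
by rewrite mulr0 addr0.
Qed.

(** Each component of [v] times one of its derivatives is the derivative of half its square. This
    turns the transport terms of the momentum balance, once tested with the velocity, into transport
    of kinetic energy per unit mass. *)
Lemma dotv_mulmx_vgrad v w x : differentiable v x ->
  dotv (v x) (w x *m vgrad v x) =
  dotv (w x) (gradient (fun y => 2^-1 * dotv (v y) (v y)) x).
Proof.
move=> dv; rewrite gradientZ; last exact: differentiable_dotv.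
have dv' a : differentiable (fun y => v y ord0 a) x.
  exact: differentiable_entry.
rewrite /dotv; under eq_bigr do rewrite mxE big_distrr.
rewrite exchange_big; apply: eq_bigr => b _ /=; rewrite !mxE partial_sum.
  rewrite mulrCA big_distrr big_distrr; apply: eq_bigr => a _ /=.
  by rewrite !mxE partialM//; field.
by move=> a; exact: differentiableM.
Qed.

End calculus.

(** * Tangent inequalities for convex and concave functions *)

Section tangents.
Variable R : realType.

Lemma derive_row_sum n (f : 'rV[R]_n -> R) (p v : 'rV[R]_n) :
  differentiable f p ->
  'D_v f p = \sum_(i < n) v ord0 i * 'D_(delta_mx ord0 i) f p.
Proof.
move=> df; rewrite deriveE// {1}(row_sum_delta v) linear_sum.
by apply: eq_bigr => i _; rewrite linearZ deriveE.
Qed.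

(** Convexity on the segment from [p] to [q] bounds the difference quotients at [p] in the direction
    [q - p] by [f q - f p], and the bound passes to the limit. *)
Lemma convex_function_tangent n (A : set 'rV[R]_n) (f : 'rV[R]_n -> R)
    (p q : 'rV[R]_n) :
  convex_function A f -> A p -> A q -> differentiable f p ->
  \sum_(i < n) (q - p) ord0 i * 'D_(delta_mx ord0 i) f p <= f q - f p.
Proof.
move=> cf Ap Aq df; rewrite -derive_row_sum//.
have dfp : derivable f p (q - p) by exact: diff_derivable.
(* Convexity controls the quotient only for 0 < h <= 1; differentiability identifies the derivative
   with the limit from the right. *)
rewrite /derive cvg_at_rightE//; apply: limr_le.
  rewrite -(cvg_at_rightE (fun h : R => h^-1 *: ((f \o shift p) _ - f p)))//.
  apply: cvg_trans dfp; apply: cvg_app.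
  move=> B [e e0 Be]; exists e => // x xe x0.
  by apply: Be => //; exact: lt0r_neq0.
near=> h.
have h0 : 0 < h by near: h; exists 1 => /=.
have h1 : h <= 1.
  near: h; exists 1 => //= y; rewrite /= sub0r normrN => y1 _.
  by rewrite (le_trans (ler_norm _)) ?ltW.
have le_f : f (h *: q + (1 - h) *: p) <= h * f q + (1 - h) * f p.
  exact: (cf (Itv01 (ltW h0) h1) q p (mem_set Aq) (mem_set Ap)).
rewrite -[_ <= _]/(h^-1 * (f (h *: (q - p) + p) - f p) <= _) ler_pdivrMl//.
have -> : h *: (q - p) + p = h *: q + (1 - h) *: p.
  by rewrite scalerBr scalerBl scale1r -!addrA; congr (_ + _); rewrite addrC.
by move: le_f; lra.
Unshelve. all: by end_near. Qed.

(* [f^`()] agrees with [g] only on [I], so [f^`(2)] is [g^`()] at interior points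
   only; the end points are reached through the continuity of [g]. *)
Lemma derive2_le0_tangent (I : set R) (f g : R -> R) (a b : R) :
  is_interval I -> (forall t, I t -> is_derive t (1 : R) f (g t)) ->
  (forall t, I t -> derivable g t 1) ->
  (forall t, I t -> derive1n 2 f t <= 0) ->
  I a -> I b -> f b - f a <= g a * (b - a).
Proof.
move=> itvI df dg f2 Ia Ib.
have nincr u v : I u -> I v -> u < v ->
    {in `[u, v] &, {homo g : x y /~ x <= y}}.
  move=> Iu Iv uv.
  have Iuv t : t \in `[u, v] -> I t by rewrite in_itv; exact: itvI.
  have Ioo t : t \in `]u, v[ -> I t.
    by rewrite in_itv /= => /andP[ut tv]; apply: Iuv; rewrite in_itv /= !ltW.
  apply: ler0_derive1_le_cc.
  - by move=> t /Ioo; exact: dg.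
  - move=> t tuv; have := f2 t (Ioo _ tuv); rewrite derive1nS derive1n1.
    rewrite !derive1E; congr (_ <= _); apply: near_eq_derive.
    near=> s; have /df ? : I s by apply: Ioo; near: s; exact: near_in_itvoo.
    by rewrite derive1E derive_val.
  - by apply: derivable_within_continuous => t /Iuv; exact: dg.
have mvt u v : I u -> I v -> u < v ->
    exists2 c, c \in `]u, v[ & f v - f u = g c * (v - u).
  move=> Iu Iv uv.
  have Iuv t : t \in `[u, v] -> I t by rewrite in_itv; exact: itvI.
  apply: MVT => // [t|].
    by rewrite in_itv /= => /andP[ut tv]; apply/df/Iuv; rewrite in_itv /= !ltW.
  by apply: derivable_within_continuous => t /Iuv /df[].
(* The increment of [f] is [g c * (b - a)] with [c] strictly between. Since [g] is nonincreasing,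
   [g c <= g a] when [a < b] and [g a <= g c] when [b < a]; the sign of [b - a] makes both cases the
   same inequality. *)
case: (ltgtP a b) => [ab|ba|->]; last by rewrite !subrr mulr0.
- have [c cab ->] := mvt _ _ Ia Ib ab.
  rewrite ler_pM2r ?subr_gt0//; apply: (nincr a b) => //.
  + exact: subset_itv_oo_cc.
  + by rewrite in_itv /= lexx ltW.
  + by rewrite (itvP cab).
- have [c cba eq_f] := mvt _ _ Ib Ia ba.
  have : g a <= g c.
    apply: (nincr b a) => //; last by rewrite (itvP cba).
      by rewrite in_itv /= lexx ltW.
    exact: subset_itv_oo_cc.
  move: eq_f; rewrite -subr_ge0 => eq_f /mulr_ge0 /(_ _); move/(_ (a - b)).
  by rewrite subr_ge0 => /(_ (ltW ba)); lra.
Unshelve. all: by end_near. Qed.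

End tangents.

(** * Measurability of open sets and linearity of the integral over them *)

Section integration.
Variables (R : realType) (d : nat) (Omega : set 'rV[R]_d).
Hypothesis oOmega : open Omega.
Implicit Types f g : 'rV[R]_d -> R.

(** Balls of row vectors are boxes, so an open set is the union of the boxes with rational centre
    and radius that it contains, a countable family. *)
Lemma measurable_row_of_tuple_preimage :
  measurable (@row_of_tuple R d @^-1` Omega).
Proof.
pose box (c : d.-tuple rat * rat) :=
  [set t : d.-tuple (measurableTypeR R) |
    forall i, (ball (ratr (tnth c.1 i) : R) (ratr c.2 : R)) (tnth t i)].
(* Boxes that leave [Omega] are replaced by the empty set, so that the union runs over the whole
   countable type of rational data. *)
pose B c := if `[< forall t, box c t -> Omega (row_of_tuple t) >] then box c
            else set0.
have -> : @row_of_tuple R d @^-1` Omega = \bigcup_c B c.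
  apply/seteqP; split => [t Ot|t [c _]]; last first.
    by rewrite /B; case: asboolP => // + ct; exact.
  have [e /= e0 eO] : nbhs_ball (row_of_tuple t) Omega.
    by apply/nbhs_ballP; exact: open_nbhs_nbhs.
  (* With a radius below [e / 2], both [t] and any point of the box are within [e / 2] of the centre
     in each coordinate, so the box stays in the ball of radius [e] at [t]. *)
  have e20 : 0 < e / 2 by rewrite divr_gt0.
  have [r] := rat_in_itvoo e20; rewrite in_itv /= => /andP[r0 re].
  have approx i : exists q : rat, ball (ratr q : R) (ratr r : R) (tnth t i).
    have /rat_in_itvoo[q] : (tnth t i : R) - ratr r < tnth t i + ratr r by lra.
    rewrite in_itv /= => /andP[q1 q2]; exists q.
    by rewrite /ball /= ltr_distl; apply/andP; split; lra.
  pose c := ([tuple xchoose (approx i) | i < d], r).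
  have near_c i : ball (ratr (tnth c.1 i) : R) (ratr c.2 : R) (tnth t i).
    by rewrite tnth_mktuple; exact: (xchooseP (approx i)).
  exists c => //; rewrite /B; case: asboolP => // -[] u cu.
  apply: eO; split=> // a b.
  rewrite !mxE; apply: (@ball_split _ _ (ratr (tnth c.1 b) : R)).
    by apply: (le_ball (ltW re)); exact/ball_sym/near_c.
  by apply: (le_ball (ltW re)); exact: cu.
apply: countable_bigcupT_measurable => [|c]; first exact: countableP.
rewrite /B; case: asboolP => _; last exact: measurable0.
apply: (@measurable_box R d
  (fun i => ball (ratr (tnth c.1 i) : R) (ratr c.2 : R))) => i.
exact: measurable_realfun.measurable_ball.
Qed.
Let mO := measurable_row_of_tuple_preimage.

Lemma integrable_overN f :
  integrable_over Omega f -> integrable_over Omega (fun x => - f x).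
Proof. by move=> If; exact: (integrableN If). Qed.

Lemma integrable_overD f g : integrable_over Omega f ->
  integrable_over Omega g -> integrable_over Omega (fun x => f x + g x).
Proof. by move=> If Ig; exact: (integrableD mO If Ig). Qed.

Lemma integrable_overB f g : integrable_over Omega f ->
  integrable_over Omega g -> integrable_over Omega (fun x => f x - g x).
Proof. by move=> If Ig; exact: (integrableB mO If Ig). Qed.

Lemma integrable_over_scale (c : R) f :
  integrable_over Omega f -> integrable_over Omega (fun x => c * f x).
Proof. by move=> If; exact: (integrableZl mO c If). Qed.

Lemma integrable_over_sum m (f : 'I_m -> 'rV[R]_d -> R) :
  (forall i, integrable_over Omega (f i)) ->
  integrable_over Omega (fun x => \sum_(i < m) f i x).
Proof.
move=> If; rewrite /integrable_over (_ : EFin \o _ = fun t : d.-tuple _ =>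
    (\sum_(i < m) (f i (row_of_tuple t))%:E)%E).
  by apply: integrable_sum => // i _; exact: If.
by apply/funext => t /=; rewrite sumEFin.
Qed.

Lemma integral_overD f g : integrable_over Omega f ->
  integrable_over Omega g ->
  integral_over Omega (fun x => f x + g x) =
  integral_over Omega f + integral_over Omega g.
Proof. by move=> If Ig; exact: (RintegralD mO If Ig). Qed.

Lemma integral_overB f g : integrable_over Omega f ->
  integrable_over Omega g ->
  integral_over Omega (fun x => f x - g x) =
  integral_over Omega f - integral_over Omega g.
Proof. by move=> If Ig; exact: (RintegralB mO If Ig). Qed.

Lemma integral_over_scale (c : R) f : integrable_over Omega f ->
  integral_over Omega (fun x => c * f x) = c * integral_over Omega f.
Proof. by move=> If; exact: RintegralZl. Qed.

Lemma integral_overN f : integrable_over Omega f ->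
  integral_over Omega (fun x => - f x) = - integral_over Omega f.
Proof.
move=> If; rewrite -mulN1r -integral_over_scale//.
by congr integral_over; apply/funext => x; rewrite mulN1r.
Qed.

Lemma integral_over_sum m (f : 'I_m -> 'rV[R]_d -> R) :
  (forall i, integrable_over Omega (f i)) ->
  integral_over Omega (fun x => \sum_(i < m) f i x) =
  \sum_(i < m) integral_over Omega (f i).
Proof.
elim: m f => [|m IHm] f If.
  (* The empty sum is written as the product [0 * 0] so that homogeneity of the integral yields the
     value 0. *)
  rewrite big_ord0 (_ : (fun x => _) = fun=> 0 * 0); last first.
    by apply/funext => x; rewrite big_ord0 mulr0.
  rewrite -[RHS](mul0r (integral_over Omega (fun=> 0))) -integral_over_scale//.
  exact: integrable0.
rewrite big_ord_recl -IHm// -integral_overD//; last exact: integrable_over_sum.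
by congr integral_over; apply/funext => x; rewrite big_ord_recl.
Qed.

Lemma le_integral_over f g : integrable_over Omega f ->
  integrable_over Omega g -> (forall x, Omega x -> f x <= g x) ->
  integral_over Omega f <= integral_over Omega g.
Proof.
by move=> If Ig fg; apply: (le_Rintegral mO If Ig) => t Ot; exact: fg.
Qed.

Lemma integral_over_ge0 f :
  (forall x, Omega x -> 0 <= f x) -> 0 <= integral_over Omega f.
Proof. by move=> f0; apply: Rintegral_ge0 => t Ot; exact: f0. Qed.

End integration.

(** * Positive semidefinite matrices acting on families of vectors *)

Section quadratic_forms.
Variable R : realType.

Lemma quadratic_formE n (A : 'M[R]_n) (v : 'rV[R]_n) :
  (v *m A *m v^T) ord0 ord0 =
  \sum_(i < n) \sum_(j < n) A i j * (v ord0 i * v ord0 j).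
Proof.
rewrite mxE exchange_big; apply: eq_bigr => j _ /=.
rewrite !mxE big_distrl; apply: eq_bigr => i _ /=; ring.
Qed.

(** Splitting the inner products by spatial coordinate gives a sum of [d] values of the quadratic
    form of [A]. *)
Lemma psd_mx_dotv_ge0 n d (A : 'M[R]_n) (p : 'I_n -> 'rV[R]_d) :
  psd_mx A -> 0 <= \sum_(i < n) \sum_(j < n) A i j * dotv (p i) (p j).
Proof.
move=> [_ A_ge0]; suff -> : \sum_(i < n) \sum_(j < n) A i j * dotv (p i) (p j) =
    \sum_(a < d) ((\row_i p i ord0 a) *m A *m (\row_i p i ord0 a)^T) ord0 ord0.
  by apply: sumr_ge0 => a _; exact: A_ge0.
under [RHS]eq_bigr do rewrite quadratic_formE.
rewrite [RHS]exchange_big; apply: eq_bigr => i _ /=.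
rewrite [RHS]exchange_big; apply: eq_bigr => j _ /=.
by rewrite big_distrr; apply: eq_bigr => a _ /=; rewrite !mxE.
Qed.

(** With B the symmetric bilinear form of [A], the right side minus the left side is half of B(p -
    q, p - q). The tangent is taken at [p], which will be the new density gradients. *)
Lemma psd_mx_tangent n d (A : 'M[R]_n) (p q : 'I_n -> 'rV[R]_d) :
  psd_mx A ->
  2^-1 * (\sum_(i < n) \sum_(j < n) A i j * dotv (p i) (p j))
  - 2^-1 * (\sum_(i < n) \sum_(j < n) A i j * dotv (q i) (q j))
  <= \sum_(i < n) \sum_(j < n) A i j * dotv (p j) (p i - q i).
Proof.
move=> psdA; have Asym i j : A i j = A j i.
  by case: psdA => At _; rewrite -[in LHS]At mxE.
pose B (r s : 'I_n -> 'rV[R]_d) :=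
  \sum_(i < n) \sum_(j < n) A i j * dotv (r i) (s j).
have Bsym r s : B r s = B s r.
  rewrite /B exchange_big; apply: eq_bigr => i _; apply: eq_bigr => j _ /=.
  by rewrite Asym dotvC.
have Bdiff r : B r (fun i => p i - q i) = B r p - B r q.
  rewrite /B -sumrB; apply: eq_bigr => i _; rewrite -sumrB.
  by apply: eq_bigr => j _; rewrite dotvBr mulrBr.
have := psd_mx_dotv_ge0 (fun i => p i - q i) psdA.
set r := fun i => p i - q i; rewrite -/(B r r) Bdiff (Bsym r p) (Bsym r q).
rewrite !Bdiff (Bsym q p).
have -> : \sum_(i < n) \sum_(j < n) A i j * dotv (p j) (p i - q i) =
    B p p - B p q.
  rewrite -Bdiff Bsym; apply: eq_bigr => i _; apply: eq_bigr => j _.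
  by rewrite dotvC.
by rewrite -/(B p p) -/(B q q); lra.
Qed.

End quadratic_forms.

(** * Tangent bounds for the free energy in temperature and in density *)

Section thermodynamics.
Variables (R : realType) (M d : nat) (Omega : set 'rV[R]_d) (F : fluid R M d).
Hypothesis hF : fluid_assumptions F Omega.

(** With the density field frozen, minus the entropy is the temperature derivative of the free
    energy, and concavity puts the graph below its tangent at [temp S x]. *)
Lemma free_energy_temp_tangent (S : state R M d) x t :
  (forall y, Omega y -> adm_density F (density S y)) ->
  differentiable_on Omega (density S) ->
  Omega x -> adm_temp F (temp S x) -> adm_temp F t ->
  free_energy_at F (density S) x t - free_energy F S x
  <= - entropy F S x * (t - temp S x).
Proof.
move=> admS dS Ox admT admt.
set nu := density S; set G := density_grad nu.
(* The temperature derivative of the free energy at frozen density: the gradient products are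
   constants here, and only the influence coefficients are differentiated. *)
pose g s := derive1 (fb F (nu x)) s
  + 2^-1 * \sum_(i < M) \sum_(j < M)
      derive1 (fun t => influence F t i j) s * dotv (G i x) (G j x).
have fE : free_energy_at F nu x = fb F (nu x)
    + 2^-1 *: \sum_(i < M) \sum_(j < M)
        dotv (G i x) (G j x) *: (fun t => influence F t i j).
  apply/funext => s; rewrite /free_energy_at /f_gradient; congr (_ + 2^-1 * _).
  rewrite fct_sumE; apply: eq_bigr => i _; rewrite fct_sumE.
  by apply: eq_bigr => j _; rewrite mulrC.
have gE : g = derive1 (fb F (nu x))
    + 2^-1 *: \sum_(i < M) \sum_(j < M)
        dotv (G i x) (G j x) *: derive1 (fun t => influence F t i j).
  apply/funext => s; rewrite /g; congr (_ + 2^-1 * _).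
  rewrite fct_sumE; apply: eq_bigr => i _; rewrite fct_sumE.
  by apply: eq_bigr => j _; rewrite mulrC.
have -> : - entropy F S x = g (temp S x) by rewrite /entropy /g; lra.
apply: (derive2_le0_tangent (adm_temp_itv hF)) => // s Is.
- have [dfb _] := fb_twice_derivable hF (admS _ Ox) Is.
  rewrite fE (_ : g s = derive1 (fb F (nu x)) s
      + 2^-1 *: \sum_(i < M) \sum_(j < M)
          dotv (G i x) (G j x) *: derive1 (fun t => influence F t i j) s).
    2: congr (_ + 2^-1 * _); apply: eq_bigr => i _; apply: eq_bigr => j _.
    2: exact: mulrC.
  apply: is_deriveD; last apply: is_deriveZ.
    by rewrite derive1E; exact: derivableP.
  apply: is_derive_sum => i; apply: is_derive_sum => j; apply: is_deriveZ.
  rewrite derive1E; apply: derivableP.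
  exact: (influence_twice_derivable hF i j Is).1.
- have [_ dfb] := fb_twice_derivable hF (admS _ Ox) Is.
  rewrite gE; apply: derivableD; [exact: dfb|apply: derivableZ].
  apply: derivable_sum => i; apply: derivable_sum => j; apply: derivableZ.
  exact: (influence_twice_derivable hF i j Is).2.
- exact: (free_energy_concave_temp hF).
Qed.

(** Here [n] plays the new density and [m] the old one. A convex function lies above its tangent at
    [n], a concave one below its tangent at [m]; both facts bound the increment from above, which is
    why the scheme treats the two parts at different time levels. The gradient energy is convex,
    hence also linearized at [n]. *)
Lemma free_energy_density_tangent (n m : 'rV[R]_d -> 'rV[R]_M) x t :
  Omega x -> adm_density F (n x) -> adm_density F (m x) -> adm_temp F t ->
  free_energy_at F n x t - free_energy_at F m x t <=
  \sum_(i < M) (n x ord0 i - m x ord0 i)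
    * ('D_(delta_mx ord0 i) (fun nu => fb_convex F nu t) (n x)
       + 'D_(delta_mx ord0 i) (fun nu => fb_concave F nu t) (m x))
  + \sum_(i < M) \sum_(j < M) influence F t i j
      * dotv (density_grad n j x) (density_grad n i x - density_grad m i x).
Proof.
move=> Ox an am at_.
pose X i := 'D_(delta_mx ord0 i) (fun nu => fb_convex F nu t) (n x).
pose Y i := 'D_(delta_mx ord0 i) (fun nu => fb_concave F nu t) (m x).
have convexT : - (\sum_(i < M) (n x ord0 i - m x ord0 i) * X i) <=
    fb_convex F (m x) t - fb_convex F (n x) t.
  have := convex_function_tangent (fb_convexP hF at_) an am
    (fb_convex_diff hF an at_).
  congr (_ <= _); rewrite -sumrN; apply: eq_bigr => i _.
  by rewrite !mxE -mulNr opprB.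
have concaveT : - (\sum_(i < M) (n x ord0 i - m x ord0 i) * Y i) <=
    - fb_concave F (n x) t - - fb_concave F (m x) t.
  have := convex_function_tangent (fb_concaveP hF at_) am an
    (differentiableN (fb_concave_diff hF am at_)).
  congr (_ <= _); rewrite -sumrN; apply: eq_bigr => i _.
  rewrite !mxE -mulrN; congr (_ * _).
  by apply: deriveN; apply: diff_derivable; exact: (fb_concave_diff hF).
have gradT := psd_mx_tangent (density_grad n ^~ x) (density_grad m ^~ x)
  (influence_psd hF at_).
have -> : \sum_(i < M) (n x ord0 i - m x ord0 i) * (X i + Y i) =
    \sum_(i < M) (n x ord0 i - m x ord0 i) * X i
    + \sum_(i < M) (n x ord0 i - m x ord0 i) * Y i.
  by rewrite -big_split; apply: eq_bigr => i _; rewrite mulrDr.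
move: gradT convexT concaveT; rewrite /free_energy_at /fb.
rewrite -/(f_gradient F n x t) -/(f_gradient F m x t).
by lra.
Qed.

End thermodynamics.

(** * The power of the viscous stress *)

Section viscous_stress.
Variables (R : realType) (M d : nat) (D : time_step R M d).

Lemma stress_sym x a b : stress D x a b = stress D x b a.
Proof. by rewrite !mxE (eq_sym b) (addrC (partial b _ x)). Qed.

(** The isotropic part sees only the trace of the velocity gradient, which is the divergence. The
    strain is symmetric, so its contraction with the velocity gradient is half its contraction with
    itself. *)
Lemma stress_vgrad x :
  \sum_(a < d) \sum_(b < d) stress D x a b * vgrad (velocity (new D)) x a b =
  viscous_dissipation D x.
Proof.
set u := velocity (new D).
have diagE : \sum_(a < d) \sum_(b < d)
    (bulk_visc D x * divergence u x) *+ (a == b) * vgrad u x a b =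
    bulk_visc D x * divergence u x ^+ 2.
  rewrite expr2 mulrA [in X in _ = _ * X]/divergence [RHS]mulr_sumr.
  apply: eq_bigr => a _.
  rewrite (bigD1 a)//= eqxx mulr1n big1 => [|b ba]; first by rewrite addr0 mxE.
  by rewrite eq_sym (negbTE ba) mulr0n mul0r.
have strainE : \sum_(a < d) \sum_(b < d) strain u x a b * vgrad u x a b =
    2^-1 * frobenius2 (strain u x).
  have swap : \sum_(a < d) \sum_(b < d) strain u x a b * vgrad u x a b =
      \sum_(a < d) \sum_(b < d) strain u x a b * vgrad u x b a.
    rewrite exchange_big; apply: eq_bigr => a _; apply: eq_bigr => b _ /=.
    by rewrite !mxE; ring.
  suff -> : frobenius2 (strain u x) =
      \sum_(a < d) \sum_(b < d) strain u x a b * vgrad u x a b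
      + \sum_(a < d) \sum_(b < d) strain u x a b * vgrad u x b a.
    by rewrite -swap; field.
  rewrite -big_split; apply: eq_bigr => a _; rewrite -big_split.
  by apply: eq_bigr => b _; rewrite /= !mxE; ring.
rewrite /viscous_dissipation real_normK ?num_real// -/u -diagE.
rewrite mulrAC -strainE [X in _ = _ + X]mulrC [X in _ = _ + X]mulr_sumr.
rewrite -big_split; apply: eq_bigr => a _ /=.
rewrite [X in _ = _ + X]mulr_sumr -big_split; apply: eq_bigr => b _ /=.
by rewrite [stress D x a b]mxE mxE [X in _ + X]mxE mulrDl -!mulrA.
Qed.

(** The product rule gives the power of the viscous force plus the dissipation; symmetry of the
    stress matches the index summed here with the one in [tensor_divergence]. *)
Lemma divergence_stress_velocity x :
  differentiable (stress D) x -> differentiable (velocity (new D)) x ->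
  divergence (fun y => \row_a \sum_(b < d)
    stress D y a b * velocity (new D) y ord0 b) x =
  dotv (velocity (new D) x) (tensor_divergence (stress D) x)
  + viscous_dissipation D x.
Proof.
move=> dS du; set u := velocity (new D).
have dSe a b : differentiable (fun y => stress D y a b) x.
  exact: differentiable_entry.
have due b : differentiable (fun y => u y ord0 b) x.
  exact: differentiable_entry.
have -> : dotv (u x) (tensor_divergence (stress D) x) =
    \sum_(a < d) \sum_(b < d)
      u x ord0 b * partial a (fun y => stress D y a b) x.
  rewrite exchange_big; apply: eq_bigr => b _ /=; rewrite mxE big_distrr.
  apply: eq_bigr => a _ /=; congr (_ * partial a _ x).
  by apply/funext => y; exact: stress_sym.
rewrite -stress_vgrad -big_split; apply: eq_bigr => a _ /=.
rewrite -big_split (_ : (fun y => _) =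
    fun y => \sum_(b < d) stress D y a b * u y ord0 b); last first.
  by apply/funext => y; rewrite mxE.
rewrite partial_sum => [|b]; last exact: (differentiableM (dSe a b) (due b)).
apply: eq_bigr => b _ /=; rewrite (partialM _ (dSe a b) (due b)) addrC.
by rewrite [vgrad _ x a b]mxE.
Qed.

Lemma differentiable_stress_velocity x :
  differentiable (stress D) x -> differentiable (velocity (new D)) x ->
  differentiable (fun y => \row_a \sum_(b < d)
    stress D y a b * velocity (new D) y ord0 b) x.
Proof.
move=> dS du; rewrite (_ : (fun y => _) = \sum_(a < d) (fun y => (\sum_(b < d)
    stress D y a b * velocity (new D) y ord0 b) *: delta_mx ord0 a)).
  apply: differentiable_sum => a; apply: differentiableZl.
  apply: differentiable_bigsum => b; apply: differentiableM.
    exact: (differentiable_entry _ _ dS).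
  exact: (differentiable_entry _ _ du).
apply/funext => y; rewrite fct_sumE [LHS]row_sum_delta.
by apply: eq_bigr => a _; rewrite mxE.
Qed.

End viscous_stress.

(** * Increment of the free energy over one time step *)

Section entropy_inequality.
Variables (R : realType) (M d : nat) (Omega : set 'rV[R]_d).
Variables (F : fluid R M d) (D : time_step R M d).
Hypothesis hF : fluid_assumptions F Omega.
Hypothesis hD : scheme_solution F D Omega.

Let adm := step_admissible hD.
Let smooth := step_smooth hD.

Let dt_neq0 : dt D != 0. Proof. exact/lt0r_neq0/(dt_gt0 adm). Qed.

Let temp_gt0 x : Omega x -> 0 < temp (new D) x.
Proof. by move=> Ox; apply: (adm_temp_gt0 hF); exact: new_temp_adm Ox. Qed.

Let diff_new i x :
  Omega x -> differentiable (fun y => density (new D) y ord0 i) x.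
Proof.
by move=> Ox; exact: (differentiable_entry _ _ (new_density_diff smooth Ox)).
Qed.

Let diff_old i x :
  Omega x -> differentiable (fun y => density (old D) y ord0 i) x.
Proof.
by move=> Ox; exact: (differentiable_entry _ _ (old_density_diff smooth Ox)).
Qed.

Lemma differentiable_dens_rate i x : Omega x -> differentiable (dens_rate D i) x.
Proof.
move=> Ox; exact: (differentiableM
  (differentiableB (diff_new i Ox) (diff_old i Ox)) (differentiable_cst _ _)).
Qed.

Lemma gradient_dens_rate i x : Omega x -> gradient (dens_rate D i) x =
  (dt D)^-1 *: (density_grad (density (new D)) i x
                - density_grad (density (old D)) i x).
Proof.
move=> Ox; rewrite -(gradientB (diff_new i Ox) (diff_old i Ox)).
rewrite -(gradientZ _ (differentiableB (diff_new i Ox) (diff_old i Ox))).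
by congr (gradient _ x); apply/funext => y; exact: mulrC.
Qed.

(** The increment is split at the intermediate state with old density and new temperature: the
    temperature tangent covers the first leg, the density tangent the second. Hence the concave
    derivative in [chem_potential] is taken at the old density but the new temperature. *)
Lemma free_energy_step x : Omega x ->
  free_energy F (new D) x - free_energy F (old D) x <=
  dt D * (\sum_(i < M) dens_rate D i x * chem_potential F D i x
    + \sum_(i < M) \sum_(j < M)
        divergence (fun y => dens_rate D i y *: influence_flux F D i j y) x)
  - entropy F (old D) x * (temp (new D) x - temp (old D) x).
Proof.
move=> Ox.
have Etemp := free_energy_temp_tangent hF (old_density_adm adm)
  (old_density_diff smooth) Ox (old_temp_adm adm Ox) (new_temp_adm adm Ox).
have Edens := free_energy_density_tangent hF Ox (new_density_adm adm Ox)
  (old_density_adm adm Ox) (new_temp_adm adm Ox).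
move: Etemp Edens.
rewrite -[free_energy_at F (density (new D)) x _]/(free_energy F (new D) x).
set rhs := (X in _ -> _ <= X -> _) => Etemp Edens.
suff rhsE : rhs = dt D * (\sum_(i < M) dens_rate D i x * chem_potential F D i x
    + \sum_(i < M) \sum_(j < M)
        divergence (fun y => dens_rate D i y *: influence_flux F D i j y) x).
  by rewrite -rhsE; lra.
rewrite /rhs mulrDr !mulr_sumr -!big_split; apply: eq_bigr => i _ /=.
set c := dens_rate D i x.
have -> : density (new D) x ord0 i - density (old D) x ord0 i = dt D * c.
  by rewrite /c /dens_rate mulrC divfK.
(* The first term of this product rule cancels the divergence inside [chem_potential]; the second is
   the tangent term of the gradient energy. *)
have divE j :
    divergence (fun y => dens_rate D i y *: influence_flux F D i j y) x =
    c * divergence (influence_flux F D i j) x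
    + (dt D)^-1 * (influence F (temp (new D) x) i j
      * dotv (density_grad (density (new D)) j x)
         (density_grad (density (new D)) i x
          - density_grad (density (old D)) i x)).
  rewrite (divergence_scale (differentiable_dens_rate i Ox)
    (influence_flux_diff smooth i j Ox)) gradient_dens_rate// dotvZr.
  by rewrite dotvC /influence_flux dotvZr dotvC.
under [X in _ = _ + _ * X]eq_bigr do rewrite divE.
rewrite big_split /= -!mulr_sumr /chem_potential.
by field.
Qed.

(** * Decomposition of the energy fluxes and their divergences *)

Let diff_velocity x : Omega x -> differentiable (velocity (new D)) x.
Proof. by move=> Ox; exact: (new_velocity_diff smooth Ox). Qed.

Let diff_star x : Omega x -> differentiable (star_velocity F D) x.
Proof. by move=> Ox; exact: (star_velocity_diff smooth Ox). Qed.

Let diff_flux i x : Omega x -> differentiable (diffusion_flux F D i) x.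
Proof. by move=> Ox; exact: (diffusion_flux_diff smooth i Ox). Qed.

Let diff_mu i x : Omega x -> differentiable (chem_potential F D i) x.
Proof. by move=> Ox; exact: (chem_potential_diff smooth i Ox). Qed.

Let kinetic y := 2^-1 * dotv (velocity (new D) y) (velocity (new D) y).
Let potential y := gravity F * height F y.

Let diff_kinetic x : Omega x -> differentiable kinetic x.
Proof.
move=> Ox; have du := diff_velocity Ox.
exact: (@differentiableZ _ _ _ _ 2^-1 _ (differentiable_dotv du du)).
Qed.

Let diff_potential x : Omega x -> differentiable potential x.
Proof.
by move=> Ox; exact: (@differentiableZ _ _ _ _ (gravity F) _ (height_diff hF Ox)).
Qed.

(* The weight of the convected component [i] in the energy flux: once the free
   energy cancels against the pressure, the flux is the temperature times the
   entropy flux plus the sum of these weights times the mass fluxes. *)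
Let psi i y := mol_weight F i * (kinetic y + potential y) + chem_potential F D i y.

Let diff_psi i x : Omega x -> differentiable (psi i) x.
Proof.
move=> Ox; have dkp := differentiableD (diff_kinetic Ox) (diff_potential Ox).
have dw := @differentiableZ _ _ _ _ (mol_weight F i) _ dkp.
exact: (differentiableD dw (diff_mu i Ox)).
Qed.

Let gradient_psi i x : Omega x -> gradient (psi i) x =
  mol_weight F i *: (gradient kinetic x + gradient potential x)
  + gradient (chem_potential F D i) x.
Proof.
move=> Ox.
have dkp := differentiableD (diff_kinetic Ox) (diff_potential Ox).
have dw : differentiable
    (fun y => mol_weight F i * (kinetic y + potential y)) x.
  exact: (@differentiableZ _ _ _ _ (mol_weight F i) _ dkp).
rewrite (gradientD dw (diff_mu i Ox)) (gradientZ _ dkp).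
by rewrite (gradientD (diff_kinetic Ox) (diff_potential Ox)).
Qed.

Let mass_flux i y := density (old D) y ord0 i *: star_velocity F D y.

Let diff_mass_flux i x : Omega x -> differentiable (mass_flux i) x.
Proof.
by move=> Ox; exact: (differentiable_scale (diff_old i Ox) (diff_star Ox)).
Qed.

Let entropy_flux y := entropy F (old D) y *: star_velocity F D y.

Let diff_entropy_flux x : Omega x -> differentiable entropy_flux x.
Proof.
move=> Ox.
exact: (differentiable_scale (old_entropy_diff smooth Ox) (diff_star Ox)).
Qed.

Let energy_fluxE y : (star_energy F D y + pressure F D y) *: star_velocity F D y =
  temp (new D) y *: entropy_flux y + \sum_(i < M) psi i y *: mass_flux i y.
Proof.
have -> : \sum_(i < M) psi i y *: mass_flux i y =
    (\sum_(i < M) psi i y * density (old D) y ord0 i) *: star_velocity F D y.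
  by rewrite scaler_suml; apply: eq_bigr => i _; rewrite scalerA.
rewrite scalerA -scalerDl; congr (_ *: _).
have -> : \sum_(i < M) psi i y * density (old D) y ord0 i =
    mass_density F (old D) y * (kinetic y + potential y)
    + \sum_(i < M) density (old D) y ord0 i * chem_potential F D i y.
  rewrite mulr_suml -big_split; apply: eq_bigr => i _ /=.
  by rewrite /psi; ring.
by rewrite /star_energy /pressure /kinetic /potential; ring.
Qed.

(** The terms are sorted by what will cancel them: divergences of mass fluxes meet the mass balance,
    the kinetic gradient meets the momentum balance, and the gradients of temperature, height and
    chemical potentials meet the definition of the intermediate velocity. *)
Let divergence_convected x : Omega x ->
  divergence
    (fun y => (star_energy F D y + pressure F D y) *: star_velocity F D y) x =
  temp (new D) x * divergence entropy_flux x
  + entropy F (old D) x * dotv (star_velocity F D x) (gradient (temp (new D)) x)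
  + (kinetic x + potential x)
    * (\sum_(i < M) mol_weight F i * divergence (mass_flux i) x)
  + \sum_(i < M) chem_potential F D i x * divergence (mass_flux i) x
  + mass_density F (old D) x
    * (dotv (star_velocity F D x) (gradient kinetic x)
       + dotv (star_velocity F D x) (gradient potential x))
  + \sum_(i < M) density (old D) x ord0 i
      * dotv (star_velocity F D x) (gradient (chem_potential F D i) x).
Proof.
move=> Ox; under [X in divergence X]eq_fun do rewrite energy_fluxE.
have dT := new_temp_diff smooth Ox.
have dS := differentiable_scale dT (diff_entropy_flux Ox).
have dpsi i := differentiable_scale (diff_psi i Ox) (diff_mass_flux i Ox).
have dsum : differentiable (fun y => \sum_(i < M) psi i y *: mass_flux i y) x.
  exact: differentiable_bigsum.
rewrite (divergenceD dS dsum) (divergence_scale dT (diff_entropy_flux Ox)).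
rewrite (divergence_sum dpsi) [dotv (entropy_flux x) _]dotvC dotvZr.
rewrite [dotv (gradient _ _) _]dotvC -!addrA; congr (_ + (_ + _)).
set w := dotv _ (gradient kinetic x) + dotv _ (gradient potential x).
rewrite mulr_sumr [mass_density _ _ _ * w]mulr_suml -!big_split.
apply: eq_bigr => i _ /=.
rewrite (divergence_scale (diff_psi i Ox) (diff_mass_flux i Ox)).
rewrite gradient_psi// [dotv (mass_flux i x) _]dotvC dotvZr dotvC.
by rewrite dotvDr dotvZr dotvDr -/w /psi; ring.
Qed.

Let extra_fluxE y : extra_flux F D y =
  \sum_(i < M) \sum_(j < M) dens_rate D i y *: influence_flux F D i j y
  - \sum_(i < M) (mol_weight F i * kinetic y) *: diffusion_flux F D i y.
Proof.
congr (_ - _); rewrite scaler_sumr; apply: eq_bigr => i _.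
by rewrite scalerA /kinetic mulrCA.
Qed.

(** The double sum is the one in [free_energy_step]. The kinetic terms offset the change of kinetic
    energy caused by mass diffusion and the diffusive transport in the momentum balance. *)
Let divergence_extra x : Omega x ->
  divergence (fun y => heat_flux F D y - extra_flux F D y) x =
  divergence (heat_flux F D) x
  - \sum_(i < M) \sum_(j < M)
      divergence (fun y => dens_rate D i y *: influence_flux F D i j y) x
  + kinetic x * (\sum_(i < M) mol_weight F i * divergence (diffusion_flux F D i) x)
  + \sum_(i < M) mol_weight F i
      * dotv (diffusion_flux F D i x) (gradient kinetic x).
Proof.
move=> Ox; under [X in divergence X]eq_fun do rewrite extra_fluxE.
have drate i j := differentiable_scale (differentiable_dens_rate i Ox)
  (influence_flux_diff smooth i j Ox).
have dk i : differentiable (fun y => mol_weight F i * kinetic y) x.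
  exact: (@differentiableZ _ _ _ _ (mol_weight F i) _ (diff_kinetic Ox)).
have dJ i := differentiable_scale (dk i) (diff_flux i Ox).
have drate' i : differentiable
    (fun y => \sum_(j < M) dens_rate D i y *: influence_flux F D i j y) x.
  exact: differentiable_bigsum (drate i).
rewrite (divergenceB (heat_flux_diff smooth Ox)
  (differentiableB (differentiable_bigsum drate') (differentiable_bigsum dJ))).
rewrite (divergenceB (differentiable_bigsum drate') (differentiable_bigsum dJ)).
rewrite (divergence_sum drate') (divergence_sum dJ).
under [X in _ - (X - _)]eq_bigr do rewrite (divergence_sum (drate _)).
rewrite opprB addrA addrAC -!addrA; congr (_ + (_ + _)).
rewrite mulr_sumr -big_split; apply: eq_bigr => i _ /=.
rewrite (divergence_scale (dk i) (diff_flux i Ox)).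
by rewrite (gradientZ _ (diff_kinetic Ox)) dotvZr; ring.
Qed.

(** * Scalar consequences of the balances, and the entropy inequalities *)

Hypothesis M_gt0 : (0 < M)%N.

Let old_mass_density_gt0 x : Omega x -> 0 < mass_density F (old D) x.
Proof.
move=> Ox; have pos i : 0 < density (old D) x ord0 i * mol_weight F i.
  apply: mulr_gt0; last exact: (mol_weight_gt0 hF).
  exact: (adm_density_gt0 hF (old_density_adm adm Ox)).
rewrite /mass_density (bigD1 (Ordinal M_gt0)) //= ltr_pwDl//.
by apply: sumr_ge0 => i _; exact: ltW.
Qed.

(** A weighted sum of the mass balances, used with the chemical potentials for the free energy and
    with the molar weights for the total mass. *)
Let sum_dens_rate (w : 'I_M -> R) x : Omega x ->
  \sum_(i < M) dens_rate D i x * w i =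
  - (\sum_(i < M) w i * divergence (mass_flux i) x
     + \sum_(i < M) w i * divergence (diffusion_flux F D i) x).
Proof.
move=> Ox; rewrite -big_split -sumrN; apply: eq_bigr => i _ /=.
rewrite -mulrDr mulrC -mulrN; congr (_ * _).
by apply/eqP; rewrite -addr_eq0 addrA; apply/eqP; exact: (mass_balanceP hD Ox).
Qed.

Let new_mass_density x : Omega x -> mass_density F (new D) x =
  mass_density F (old D) x
  - dt D * (\sum_(i < M) mol_weight F i * divergence (mass_flux i) x
     + \sum_(i < M) mol_weight F i * divergence (diffusion_flux F D i) x).
Proof.
move=> Ox; rewrite -mulrN -(sum_dens_rate _ Ox) mulr_sumr -big_split.
apply: eq_bigr => i _ /=; rewrite /dens_rate.
by field.
Qed.

(** The momentum balance tested with the new velocity; [dotv_mulmx_vgrad] rewrites both transport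
    terms. *)
Let momentum_dot_velocity x : Omega x ->
  mass_density F (old D) x
  * ((dt D)^-1 * (dotv (velocity (new D) x) (velocity (new D) x)
                  - dotv (velocity (new D) x) (star_velocity F D x))
     + dotv (star_velocity F D x) (gradient kinetic x))
  + \sum_(i < M) mol_weight F i
      * dotv (diffusion_flux F D i x) (gradient kinetic x)
  = dotv (velocity (new D) x) (tensor_divergence (stress D) x).
Proof.
move=> Ox; rewrite -(momentum_balanceP hD Ox) [RHS]dotvDr dotvZr.
rewrite [dotv _ (_ + _ *m _)]dotvDr dotvZr (dotvBr _ _ (star_velocity F D x)).
rewrite (dotv_mulmx_vgrad _ (diff_velocity Ox)) dotv_sumr; congr (_ + _).
apply: eq_bigr => i _.
by rewrite dotvZr (dotv_mulmx_vgrad _ (diff_velocity Ox)).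
Qed.

(** The definition of the intermediate velocity tested with that velocity. Gravity being minus the
    gradient of the potential, it enters with the same sign as the other forces. *)
Let star_velocity_dot x : Omega x ->
  mass_density F (old D) x
  * (dotv (star_velocity F D x) (star_velocity F D x)
     - dotv (star_velocity F D x) (velocity (old D) x)) =
  - dt D * (\sum_(i < M) density (old D) x ord0 i
        * dotv (star_velocity F D x) (gradient (chem_potential F D i) x)
      + entropy F (old D) x
        * dotv (star_velocity F D x) (gradient (temp (new D)) x)
      + mass_density F (old D) x
        * dotv (star_velocity F D x) (gradient potential x)).
Proof.
move=> Ox; have rho0 := lt0r_neq0 (old_mass_density_gt0 Ox).
(* Only the second factor of the first product is unfolded; the tested velocity stays a symbol. *)
set us := star_velocity F D x; rewrite {2}/us /star_velocity.
set force := \sum_(i < M) _ + _ - _; clearbody us.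
have -> : dotv us (velocity (old D) x - (dt D / mass_density F (old D) x) *: force)
    = dotv us (velocity (old D) x) - dt D / mass_density F (old D) x * dotv us force.
  by rewrite dotvBr dotvZr.
have -> : dotv us force = \sum_(i < M) density (old D) x ord0 i
        * dotv us (gradient (chem_potential F D i) x)
      + entropy F (old D) x * dotv us (gradient (temp (new D)) x)
      + mass_density F (old D) x * dotv us (gradient potential x).
  rewrite (gradientZ _ (height_diff hF Ox)) dotvBr dotvDr dotv_sumr !dotvZr.
  rewrite /gravity_vec dotvNr mulrN opprK dotvZr; congr (_ + _ + _).
  by apply: eq_bigr => i _; rewrite dotvZr.
by field.
Qed.

(** The local inequality before division by the temperature. Of all terms containing the
    intermediate velocity, only the entropy transport survives; the mass diffusion terms keep the
    weights of the chemical and gravitational potentials. *)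
Lemma entropy_step x : Omega x ->
  dt D * (- divergence (heat_flux F D) x
    - temp (new D) x
      * divergence (fun y => entropy F (old D) y *: star_velocity F D y) x
    + \sum_(i < M)
        (chem_potential F D i x + mol_weight F i * gravity F * height F x)
        * divergence (diffusion_flux F D i) x
    + viscous_dissipation D x) <=
  temp (new D) x * (entropy F (new D) x - entropy F (old D) x).
Proof.
move=> Ox; have Efree := free_energy_step Ox; rewrite sum_dens_rate// in Efree.
have Eenergy := energy_balanceP hD Ox; rewrite /energy_balance in Eenergy.
have dEflux : differentiable
    (fun y => (star_energy F D y + pressure F D y) *: star_velocity F D y) x.
  under eq_fun do rewrite energy_fluxE.
  apply: differentiableD.
    exact: (differentiable_scale (new_temp_diff smooth Ox) (diff_entropy_flux Ox)).
  apply: differentiable_bigsum => i.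
  exact: (differentiable_scale (diff_psi i Ox) (diff_mass_flux i Ox)).
have dS := stress_diff smooth Ox; have du := diff_velocity Ox.
rewrite (divergenceB dEflux (differentiable_stress_velocity dS du)) in Eenergy.
rewrite (divergence_stress_velocity dS du) (divergence_convected Ox) in Eenergy.
rewrite (divergence_extra Ox) -(momentum_dot_velocity Ox) in Eenergy.
rewrite /total_energy (new_mass_density Ox) in Eenergy.
have Estar := star_velocity_dot Ox.
have sq1 := dotv_ge0 (velocity (new D) x - star_velocity F D x).
have sq2 := dotv_ge0 (star_velocity F D x - velocity (old D) x).
rewrite dotv_sqrB in sq1; rewrite dotv_sqrB in sq2.
have -> : \sum_(i < M) (chem_potential F D i x + mol_weight F i * gravity F * height F x)
      * divergence (diffusion_flux F D i) x =
    \sum_(i < M) chem_potential F D i x * divergence (diffusion_flux F D i) x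
    + potential x * \sum_(i < M) mol_weight F i * divergence (diffusion_flux F D i) x.
  rewrite mulr_sumr -big_split; apply: eq_bigr => i _ /=.
  by rewrite /potential; ring.
rewrite -/entropy_flux.
have dt0 := dt_gt0 adm; have rho0 := old_mass_density_gt0 Ox.
rewrite [kinetic x]/kinetic [potential x]/potential in Eenergy *.
move: dt0 rho0 Efree Eenergy Estar sq1 sq2.
set dA := \sum_(i < M) mol_weight F i * divergence (mass_flux i) x.
set dJ := \sum_(i < M) mol_weight F i * divergence (diffusion_flux F D i) x.
set muA := \sum_(i < M) chem_potential F D i x * divergence (mass_flux i) x.
set muJ := \sum_(i < M) chem_potential F D i x * divergence (diffusion_flux F D i) x.
set dmuN := \sum_(i < M) density (old D) x ord0 i * _.
set Jk := \sum_(i < M) mol_weight F i * dotv _ _.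
set dpi := \sum_(i < M) \sum_(j < M) _.
set uu := dotv (velocity (new D) x) (velocity (new D) x).
set us := dotv (velocity (new D) x) (star_velocity F D x).
set ss := dotv (star_velocity F D x) (star_velocity F D x).
set so := dotv (star_velocity F D x) (velocity (old D) x).
set oo := dotv (velocity (old D) x) (velocity (old D) x).
set sT := dotv _ (gradient (temp (new D)) x).
set sK := dotv _ (gradient kinetic x).
set sP := dotv _ (gradient potential x).
set rho := mass_density F (old D) x.
move: (dt D) (temp (new D) x) (temp (old D) x) (entropy F (old D) x)
  (entropy F (new D) x) (free_energy F (new D) x) (free_energy F (old D) x)
  (divergence entropy_flux x) (divergence (heat_flux F D) x)
  (viscous_dissipation D x) (gravity F) (height F x).
move=> t T1 T0 s0 s1 f1 f0 dS' dq Phi g h t0 rho0 Efree Eenergy Estar sq1 sq2.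
clearbody dA dJ muA muJ dmuN Jk dpi uu us ss so oo sT sK sP rho.
have dtE : t * (rho * (t^-1 * (uu - us))) = rho * (uu - us).
  by rewrite mulrCA mulVKf// lt0r_neq0.
(* The energy balance is multiplied by the time step to clear every division; the rest is then
   linear in the monomials. *)
have {}Eenergy : (f1 + T1 * s1 + 2^-1 * (rho - t * (dA + dJ)) * uu
    + (rho - t * (dA + dJ)) * g * h
    - (f0 + T0 * s0 + 2^-1 * rho * oo + rho * g * h)) =
    t * (- (dq - dpi + 2^-1 * uu * dJ + Jk)
      - (T1 * dS' + s0 * sT + (2^-1 * uu + g * h) * dA + muA + rho * (sK + sP)
         + dmuN - (rho * sK + Jk + Phi)))
    + rho * (uu - us).
  rewrite -dtE -Eenergy; field.
  by rewrite lt0r_neq0.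
(* Half of this quantity is the excess of [rho * (uu - us) + rho * (ss - so)], known from the
   momentum balance and the intermediate velocity, over the kinetic increment
   [rho * (uu - oo) / 2]. *)
have kin : 0 <= rho * ((uu - 2 * us + ss) + (ss - 2 * so + oo)).
  by rewrite mulr_ge0 ?(ltW rho0)// addr_ge0.
by lra.
Qed.

(** By the product rule the gradient terms cancel those hidden in the divergences of the weighted
    fluxes; what remains is [entropy_step] divided by the temperature and the time step. *)
Lemma local_entropy_inequality x : Omega x ->
  - divergence (fun y => (temp (new D) y)^-1 *: heat_flux F D y) x
  - divergence (fun y => entropy F (old D) y *: star_velocity F D y) x
  + \sum_(i < M) divergence
      (fun y => reduced_potential F D i y *: diffusion_flux F D i y) x
  + dotv (heat_flux F D x) (gradient (inv_temp D) x)
  - \sum_(i < M) dotv (diffusion_flux F D i x)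
                      (gradient (reduced_potential F D i) x)
  + inv_temp D x * viscous_dissipation D x
  <= (entropy F (new D) x - entropy F (old D) x) / dt D.
Proof.
move=> Ox; have T0 := temp_gt0 Ox; have T_neq0 := lt0r_neq0 T0.
have dinvT : differentiable (fun y => (temp (new D) y)^-1) x.
  exact: (differentiableV (new_temp_diff smooth Ox)).
have dRP i : differentiable (reduced_potential F D i) x.
  have dh := @differentiableZ _ _ _ _ (mol_weight F i * gravity F) _
    (height_diff hF Ox).
  exact: (differentiableM (differentiableD (diff_mu i Ox) dh) dinvT).
have invTE : inv_temp D = fun y => (temp (new D) y)^-1.
  by apply/funext => y; rewrite /inv_temp div1r.
rewrite (divergence_scale dinvT (heat_flux_diff smooth Ox)) -invTE.
have -> : \sum_(i < M) divergence
      (fun y => reduced_potential F D i y *: diffusion_flux F D i y) x =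
    (temp (new D) x)^-1 * (\sum_(i < M)
      (chem_potential F D i x + mol_weight F i * gravity F * height F x)
        * divergence (diffusion_flux F D i) x)
    + \sum_(i < M) dotv (diffusion_flux F D i x)
                        (gradient (reduced_potential F D i) x).
  rewrite mulr_sumr -big_split; apply: eq_bigr => i _ /=.
  rewrite (divergence_scale (dRP i) (diff_flux i Ox)).
  by rewrite /reduced_potential; congr (_ + _); ring.
rewrite invTE ler_pdivlMr ?(dt_gt0 adm)// -(ler_pM2l T0).
apply: le_trans (entropy_step Ox); rewrite le_eqVlt; apply/orP; left; apply/eqP.
by field.
Qed.

(** The fluxes are [flux_coef] applied to the thermodynamic forces, so the production is its
    quadratic form at these forces. *)
Lemma entropy_production_flux_ge0 x : Omega x ->
  0 <= dotv (heat_flux F D x) (gradient (inv_temp D) x)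
     - \sum_(i < M) dotv (diffusion_flux F D i x)
                         (gradient (reduced_potential F D i) x).
Proof.
(* The forces: minus the gradients of the reduced potentials for the components, and the gradient of
   the inverse temperature in the last position, [ord_max]. *)
move=> Ox; pose p (a : 'I_M.+1) : 'rV[R]_d :=
  if unlift ord_max a is Some i then - gradient (reduced_potential F D i) x
  else gradient (inv_temp D) x.
have compE i : widen_ord (leqnSn M) i = lift ord_max i.
  by apply: val_inj; rewrite /= /bump leqNgt ltn_ord.
have pcomp i : p (widen_ord (leqnSn M) i) = - gradient (reduced_potential F D i) x.
  by rewrite /p compE liftK.
have pheat : p ord_max = gradient (inv_temp D) x by rewrite /p unlift_none.
have comp_heat i : (widen_ord (leqnSn M) i == ord_max) = false.
  by rewrite compE eq_sym; apply/negbTE; exact: neq_lift.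
have fluxE (a : 'I_M.+1) : \sum_b flux_coef F D x a b *: p b =
    if unlift ord_max a is Some i then diffusion_flux F D i x else heat_flux F D x.
  rewrite big_ord_recr /= pheat; under eq_bigr do rewrite pcomp scalerN.
  rewrite sumrN; case: (unliftP ord_max a) => [i|] ->; congr (- _ + _).
  - by apply: eq_bigr => j _; rewrite mxE -compE comp_heat.
  - by rewrite mxE -compE comp_heat.
  - by apply: eq_bigr => j _; rewrite mxE comp_heat andbF.
  - by rewrite mxE eqxx.
have := psd_mx_dotv_ge0 p (flux_coef_psd adm Ox).
have -> : \sum_a \sum_b flux_coef F D x a b * dotv (p a) (p b) =
    \sum_a dotv (p a) (\sum_b flux_coef F D x a b *: p b).
  apply: eq_bigr => a _; rewrite dotv_sumr.
  by apply: eq_bigr => b _; rewrite dotvZr.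
rewrite big_ord_recr /= fluxE unlift_none pheat [dotv _ (heat_flux _ _ _)]dotvC.
congr (_ <= _); rewrite addrC; congr (_ + _); rewrite -sumrN.
apply: eq_bigr => i _; rewrite fluxE pcomp compE liftK.
by rewrite dotvC dotvNr.
Qed.

Lemma viscous_dissipation_ge0 x :
  Omega x -> 0 <= viscous_dissipation D x * inv_temp D x.
Proof.
move=> Ox; apply: mulr_ge0; last by rewrite divr_ge0 ?ler01 ?(ltW (temp_gt0 Ox)).
have bulk0 := ltW (bulk_visc_gt0 adm Ox); have shear0 := ltW (shear_visc_gt0 adm Ox).
apply: addr_ge0; apply: mulr_ge0 => //.
  by rewrite mulr_ge0// invr_ge0.
by apply: sumr_ge0 => a _; apply: sumr_ge0 => b _; exact: sqr_ge0.
Qed.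

(** Integration of the local inequality: isolation removes the three divergences, and nonnegativity
    of the production holds pointwise. Openness of [Omega] makes the domain of integration
    measurable. *)
Lemma integrated_entropy_inequality :
  open Omega -> isolated_system F D Omega -> finite_entropy_integrals F D Omega ->
  let production :=
    integral_over Omega
      (fun x => dotv (heat_flux F D x) (gradient (inv_temp D) x))
    - \sum_(i < M) integral_over Omega
        (fun x => dotv (diffusion_flux F D i x)
                       (gradient (reduced_potential F D i) x))
    + integral_over Omega
        (fun x => viscous_dissipation D x * inv_temp D x) in
  production <= (integral_over Omega (entropy F (new D))
     - integral_over Omega (entropy F (old D))) / dt D
  /\ 0 <= production.
Proof.
move=> oO [[Iq q0] [Is S0] J] [Iold Inew Iqp IJp Ivisc] production.
pose flux_production x := dotv (heat_flux F D x) (gradient (inv_temp D) x)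
  - \sum_(i < M) dotv (diffusion_flux F D i x)
                      (gradient (reduced_potential F D i) x).
pose visc x := viscous_dissipation D x * inv_temp D x.
have IsumJ := integrable_over_sum oO IJp.
have Iflux : integrable_over Omega flux_production.
  exact: (integrable_overB oO Iqp IsumJ).
have productionE : production =
    integral_over Omega (fun x => flux_production x + visc x).
  rewrite (integral_overD oO Iflux Ivisc) (integral_overB oO Iqp IsumJ).
  by rewrite (integral_over_sum oO IJp).
split; last first.
  rewrite productionE; apply: integral_over_ge0 => x Ox; apply: addr_ge0.
    exact: entropy_production_flux_ge0.
  exact: viscous_dissipation_ge0.
pose divq := divergence (fun y => (temp (new D) y)^-1 *: heat_flux F D y).
pose divs := divergence (fun y => entropy F (old D) y *: star_velocity F D y).
pose divJ i := divergence
  (fun y => reduced_potential F D i y *: diffusion_flux F D i y).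
have IdivJ i : integrable_over Omega (divJ i) by case: (J i).
have IsumdivJ := integrable_over_sum oO IdivJ.
rewrite -/divq -/divs in Iq q0 Is S0.
have Idiv : integrable_over Omega (fun x => - divq x - divs x).
  exact: (integrable_overB oO (integrable_overN Iq) Is).
have IdivD := integrable_overD oO Idiv IsumdivJ.
have div0 : integral_over Omega
    (fun x => (- divq x - divs x) + \sum_(i < M) divJ i x) = 0.
  rewrite (integral_overD oO Idiv IsumdivJ) (integral_over_sum oO IdivJ).
  rewrite (integral_overB oO (integrable_overN Iq) Is) (integral_overN oO Iq).
  rewrite q0 S0 big1 => [|i _]; last by case: (J i).
  by rewrite oppr0 !addr0.
have Iprod := integrable_overD oO Iflux Ivisc.
have Irate := integrable_over_scale oO (dt D)^-1 (integrable_overB oO Inew Iold).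
rewrite productionE mulrC -(integral_overB oO Inew Iold).
rewrite -(integral_over_scale oO _ (integrable_overB oO Inew Iold)).
(* The vanishing integral of the divergences is added back, so that the integrands can be compared
   pointwise. *)
rewrite -[X in X <= _]add0r -div0 -(integral_overD oO IdivD Iprod).
apply: (le_integral_over oO (integrable_overD oO IdivD Iprod) Irate) => x Ox.
rewrite [leRHS]mulrC; apply: le_trans (local_entropy_inequality Ox).
rewrite le_eqVlt; apply/orP; left; apply/eqP.
by rewrite /divq /divs /divJ /flux_production /visc; ring.
Qed.

End entropy_inequality.

Theorem theorem4p1 (R : realType) (M d : nat) (Omega : set 'rV[R]_d)
    (F : fluid R M d) (D : time_step R M d) :
  (0 < M)%N -> (0 < d)%N ->
  bounded_domain Omega ->
  fluid_assumptions F Omega ->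
  scheme_solution F D Omega ->
  (forall x, Omega x ->
     (entropy F (new D) x - entropy F (old D) x) / dt D >=
     - divergence (fun y => (temp (new D) y)^-1 *: heat_flux F D y) x
     - divergence (fun y => entropy F (old D) y *: star_velocity F D y) x
     + \sum_(i < M) divergence
         (fun y => reduced_potential F D i y *: diffusion_flux F D i y) x
     + dotv (heat_flux F D x) (gradient (inv_temp D) x)
     - \sum_(i < M) dotv (diffusion_flux F D i x)
                         (gradient (reduced_potential F D i) x)
     + inv_temp D x * viscous_dissipation D x)
  /\
  (isolated_system F D Omega -> finite_entropy_integrals F D Omega ->
     let production :=
       integral_over Omega
         (fun x => dotv (heat_flux F D x) (gradient (inv_temp D) x))
       - \sum_(i < M) integral_over Omega
           (fun x => dotv (diffusion_flux F D i x)
                          (gradient (reduced_potential F D i) x))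
       + integral_over Omega
           (fun x => viscous_dissipation D x * inv_temp D x) in
     (integral_over Omega (entropy F (new D))
        - integral_over Omega (entropy F (old D))) / dt D >= production
     /\ production >= 0).
Proof.
move=> M0 _ [oOmega _ _ _] hF hD; split.
  by move=> x Ox; exact: (local_entropy_inequality hF hD M0 Ox).
exact: (integrated_entropy_inequality hF hD M0 oOmega).
Qed.
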